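(* Let $R$ be a commutative ring with unit, $d$ a positive integer, $G$ an abelian group, $e_1,\dots,e_d\in G$ distinct elements, and $S\subset G$ a subset such that $a\in S$ implies $a+e_i\in S$ for all $i=1,\dots,d$. With the modules $\Omega^q(S)$, $N_q(S)$ and the maps $D_q$, $D'_q$, $B_q$ defined in the context, we have $$D_{q+1}D_q\equiv 0\quad (q=1,\dots,d-1),\qquad D'_qD'_{q+1}\equiv 0\quad (q=1,\dots,d-1),$$ and $$B_q(D_q\omega_{q-1},A_q)=B_{q-1}(\omega_{q-1},D'_qA_q)\quad (q=1,\dots,d)$$ for all $\omega_{q-1}\in\Omega^{q-1}(S)$ and $A_q\in N_q(S)$.
   Context: $\mathcal{A}(S)$ denotes the ring of all maps $S\to R$ (pointwise operations). For $f\in\mathcal{A}(S)$ define $\partial_i f\in\mathcal{A}(S)$ by $(\partial_i f)(a)=f(a+e_i)-f(a)$. Let $M$ be the free $\mathcal{A}(S)$-module with basis formal symbols $dx_1,\dots,dx_d$ and $\Omega^q(S)=\bigwedge^q_{\mathcal{A}(S)}M$ ($0\le q\le d$), so every element of $\Omega^q(S)$ is uniquely $\sum_{1\le i_1<\dots<i_q\le d} f_{i_1\cdots i_q}\,dx_{i_1}\wedge\cdots\wedge dx_{i_q}$ with $f_{i_1\cdots i_q}\in\mathcal{A}(S)$; $\Omega^0(S)=\mathcal{A}(S)$. Define $D_1:\Omega^0(S)\to\Omega^1(S)$ by $D_1f=\sum_{i=1}^d\partial_i f\,dx_i$, and for $q=2,\dots,d$, $D_q:\Omega^{q-1}(S)\to\Omega^q(S)$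 by $D_q\big(\sum f_{i_1\cdots i_{q-1}}dx_{i_1}\wedge\cdots\wedge dx_{i_{q-1}}\big)=\sum D_1(f_{i_1\cdots i_{q-1}})\wedge dx_{i_1}\wedge\cdots\wedge dx_{i_{q-1}}$. Let $N_0(S)$ be the free $R$-module on formal symbols $[a]$, $a\in S$, and for $1\le q\le d$ let $N_q(S)$ be the free $R$-module on formal symbols $[a:e_{l_1},\dots,e_{l_q}]$ with $a\in S$ and $1\le l_1<\dots<l_q\le d$. Define $R$-linear maps $D'_q:N_q(S)\to N_{q-1}(S)$ by $D'_1[a:e_l]=[a+e_l]-[a]$ and, for $q\ge2$ and $A=[a:e_{l_1},\dots,e_{l_q}]$ ($l_1<\dots<l_q$), $$D'_q(A)=\sum_{i=1}^q(-1)^{i-1}\big([a+e_{l_i}:e_{l_1},\dots,\widehat{e_{l_i}},\dots,e_{l_q}]-[a:e_{l_1},\dots,\widehat{e_{l_i}},\dots,e_{l_q}]\big),$$ where the hat denotes omission. Define $R$-bilinear maps $B_q:\Omega^q(S)\times N_q(S)\to R$ by $B_0(f,[a])=f(a)$ and, for $q\ge1$, $B_q\big(\sum f_{i_1\cdots i_q}dx_{i_1}\wedge\cdots\wedge dx_{i_q},[a:e_{l_1},\dots,e_{l_q}]\big)=f_{l_1\cdots l_q}(a)$, extended bilinearly. *)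

(* Defs.v *)
From HB Require Import structures.
From mathcomp Require Import all_boot all_order all_algebra.
From mathcomp Require Import mathcomp_extra boolp classical_sets functions.
From mathcomp Require Import finmap.
From mathcomp.multinomials Require Import monalg.

Set Implicit Arguments.
Unset Strict Implicit.
Unset Printing Implicit Defensive.

Import GRing.Theory.
Local Open Scope ring_scope.

(* The free module on K.  The library gives {malg R[K]} (finitely supported   *)
(* families of coefficients) a module structure only when 1 != 0 in R; the    *)
(* alias freemod carries the same structure without that restriction.         *)
Definition freemod (R : comPzRingType) (K : choiceType) : Type := {malg R[K]}.

HB.instance Definition _ (R : comPzRingType) (K : choiceType) :=
  GRing.Zmodule.copy (freemod R K) {malg R[K]}.

Section FreeModule.
Variables (R : comPzRingType) (K : choiceType).
Implicit Types (c : R) (g : freemod R K) (k : K).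

Definition fscale c g : freemod R K :=
  \sum_(k <- msupp g) (<< c * g@_k *g k >> : {malg R[K]}).

Lemma mcoeff_fscale c g k : (fscale c g)@_k = c * g@_k.
Proof.
rewrite [in RHS](monalgE g) /fscale !raddf_sum mulr_sumr.
by apply: eq_bigr => /= i _; rewrite !mcoeffU mulrnAr.
Qed.

Lemma fscaleA c1 c2 g : fscale c1 (fscale c2 g) = fscale (c1 * c2) g.
Proof. by apply/malgP => x; rewrite !mcoeff_fscale mulrA. Qed.

Lemma fscale1 : left_id 1 fscale.
Proof. by move=> g; apply/malgP => x; rewrite mcoeff_fscale mul1r. Qed.

Lemma fscaleDr : right_distributive fscale +%R.
Proof.
by move=> c g h; apply/malgP => x; rewrite !(mcoeffD, mcoeff_fscale) mulrDr.
Qed.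

Lemma fscaleDl g : {morph fscale^~ g : c1 c2 / c1 + c2}.
Proof.
by move=> c1 c2; apply/malgP => x; rewrite !(mcoeffD, mcoeff_fscale) mulrDl.
Qed.

HB.instance Definition _ := GRing.Zmodule_isLmodule.Build R (freemod R K)
  fscaleA fscale1 fscaleDr fscaleDl.

Definition fbasis k : freemod R K := << 1 *g k >>.

(* The R-linear extension to freemod R K of a map defined on basis elements. *)
Definition lext (V : lmodType R) (h : K -> V) g : V :=
  \sum_(k <- msupp g) g@_k *: h k.

Variables (V : lmodType R) (h : K -> V).

Lemma lextEw g (X : {fset K}) : (msupp g `<=` X)%fset ->
  lext h g = \sum_(k <- X) g@_k *: h k.
Proof.
move=> gX; rewrite /lext (big_fset_incl _ gX) // => k _ kg.
by rewrite mcoeff_outdom // scale0r.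
Qed.

Lemma lext_basis k : lext h (fbasis k) = h k.
Proof.
rewrite (lextEw (X := [fset k]%fset)); last exact: msuppU_le.
by rewrite big_seq_fset1 mcoeffUU scale1r.
Qed.

Lemma lext_is_linear : linear (lext h).
Proof.
move=> c g1 g2; set X := (msupp (c *: g1 + g2) `|` (msupp g1 `|` msupp g2))%fset.
rewrite !(@lextEw _ X) ?fsubsetUl // /X.
- rewrite scaler_sumr -big_split; apply: eq_bigr => k _ /=.
  by rewrite mcoeffD mcoeff_fscale scalerDl scalerA.
- by rewrite (fsubset_trans _ (fsubsetUr _ _)) // fsubsetUr.
- by rewrite (fsubset_trans _ (fsubsetUr _ _)) // fsubsetUl.
Qed.

HB.instance Definition _ :=
  GRing.isLinear.Build R (freemod R K) V _ (lext h) lext_is_linear.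

End FreeModule.

(* A q-element subset of 'I_d stands for the increasing sequence of its       *)
(* elements l_1 < ... < l_q; these are, in order, the enum_val i, i < #|I|.   *)
Definition qset (d q : nat) : Type := {I : {set 'I_d} | #|I| == q}.

HB.instance Definition _ d q := SubFinite.on (qset d q).

Definition qset1 d (i : 'I_d) : qset d 1 := exist _ [set i]%SET (introT eqP (cards1 i)).

Lemma card_qsetD1 d q (I : qset d q.+1) (i : 'I_#|val I|) :
  #|(val I :\ enum_val i)%SET| == q.
Proof. by have := valP I; rewrite (cardsD1 (enum_val i)) enum_valP. Qed.

Definition qsetD1 d q (I : qset d q.+1) (i : 'I_#|val I|) : qset d q :=
  exist _ (val I :\ enum_val i)%SET (card_qsetD1 i).

(* The q-th exterior power of the free A-module with basis dx_1, ..., dx_d,   *)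
(* in coordinates on the basis dx_I := dx_{l_1} /\ ... /\ dx_{l_q}: w I is    *)
(* the coefficient of dx_I in w.                                              *)
Definition extpow (A : comPzRingType) (d q : nat) : Type := {ffun qset d q -> A^o}.

HB.instance Definition _ (A : comPzRingType) d q :=
  GRing.Lmodule.on (extpow A d q).

Section Exterior.
Variables (A : comPzRingType) (d : nat).
Local Notation ext := (extpow A d).

Definition dx q (I : qset d q) : ext q := [ffun J => (J == I)%:R].

Definition inversions (I J : {set 'I_d}) : nat :=
  #|[set p in finset.setX I J | (p.2 < p.1)%N]%SET|.

(* dx_I /\ dx_J = wsign I J * dx_(I U J), understood as 0 if I meets J.       *)
Definition wsign (I J : {set 'I_d}) : A :=
  if [disjoint I & J] then (-1) ^+ inversions I J else 0.

Definition wedge p q (w : ext p) (z : ext q) : ext (p + q)%N :=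
  [ffun L => \sum_(I : qset d p)
               \sum_(J : qset d q | (val I :|: val J == val L)%SET)
                 wsign (val I) (val J) * w I * z J].

(* The properties characterising the exterior algebra: the dx_I form a basis, *)
(* wedge is bilinear, associative and alternating on degree 1, and dx_I is    *)
(* the product of its dx_{l_i} in increasing order.                           *)
Lemma extpowE q (w : ext q) : w = \sum_(I : qset d q) (w I : A) *: dx I.
Proof.
apply/ffunP => J; rewrite sum_ffunE (bigD1 J) //= big1 => [|I neIJ].
  by rewrite !ffunE eqxx addr0 /GRing.scale /= mulr1.
by rewrite !ffunE eq_sym (negPf neIJ) scaler0.
Qed.

Lemma wedge_linearl p q (z : ext q) : linear (fun w : ext p => wedge w z).
Proof.
move=> c w1 w2; apply/ffunP => L; rewrite !ffunE scaler_sumr -big_split.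
apply: eq_bigr => I _; rewrite scaler_sumr -big_split; apply: eq_bigr => J _ /=.
by rewrite !ffunE /GRing.scale /= mulrDr mulrDl mulrCA -!mulrA.
Qed.

Lemma wedge_linearr p q (w : ext p) : linear (wedge w : ext q -> _).
Proof.
move=> c z1 z2; apply/ffunP => L; rewrite !ffunE scaler_sumr -big_split.
apply: eq_bigr => I _; rewrite scaler_sumr -big_split; apply: eq_bigr => J _ /=.
by rewrite !ffunE /GRing.scale /= mulrDr mulrCA.
Qed.

Lemma inversionsUl (I J K : {set 'I_d}) : [disjoint I & J] ->
  inversions (I :|: J)%SET K = (inversions I K + inversions J K)%N.
Proof.
move=> dIJ; rewrite /inversions -cardsUI [X in (_ + X)%N](_ : _ = 0%N) ?addn0.
  by apply: eq_card => -[i k]; rewrite !inE /= !andb_orl.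
apply: eq_card0 => -[i k]; rewrite !inE /=; apply/negP.
case/andP => /andP[/andP[iI _] _] /andP[/andP[iJ _] _].
by have := disjointFr dIJ iI; rewrite iJ.
Qed.

Lemma inversionsUr (I J K : {set 'I_d}) : [disjoint J & K] ->
  inversions I (J :|: K)%SET = (inversions I J + inversions I K)%N.
Proof.
move=> dJK; rewrite /inversions -cardsUI [X in (_ + X)%N](_ : _ = 0%N) ?addn0.
  by apply: eq_card => -[i k]; rewrite !inE /= andb_orr !andb_orl.
apply: eq_card0 => -[i k]; rewrite !inE /=; apply/negP.
case/andP => /andP[/andP[_ kJ] _] /andP[/andP[_ kK] _].
by have := disjointFr dJK kJ; rewrite kK.
Qed.

Lemma wsignA (I J K : {set 'I_d}) :
  wsign (I :|: J)%SET K * wsign I J = wsign I (J :|: K)%SET * wsign J K.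
Proof.
rewrite /wsign; have dUl : [disjoint (I :|: J)%SET & K] =
    [disjoint I & K] && [disjoint J & K].
  by rewrite -disjointU; apply: eq_disjoint => i; rewrite !inE.
have dUr : [disjoint I & (J :|: K)%SET] = [disjoint I & J] && [disjoint I & K].
  rewrite !(disjoint_sym I) -disjointU.
  by apply: eq_disjoint => i; rewrite !inE.
rewrite dUl dUr; case dIJ : [disjoint I & J]; case dIK : [disjoint I & K];
  case dJK : [disjoint J & K]; rewrite /= ?(mulr0, mul0r) //.
by rewrite inversionsUl // inversionsUr // -!exprD [in LHS]addnC addnA.
Qed.

Lemma wedgeA p q r (w : ext p) (y : ext q) (z : ext r)
    (L : qset d (p + q + r)) (L' : qset d (p + (q + r))) : val L = val L' ->
  wedge (wedge w y) z L = wedge w (wedge y z) L'.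
Proof.
move=> LL'; rewrite !ffunE.
pose T (I : qset d p) (J : qset d q) (K : qset d r) : A :=
  if (val I :|: val J :|: val K == val L)%SET then
    wsign (val I :|: val J)%SET (val K) * wsign (val I) (val J)
      * (w I * y J * z K) else 0.
have qsetU m n (I : qset d m) (J : qset d n) :
    [disjoint val I & val J] -> #|(val I :|: val J)%SET| == (m + n)%N.
  rewrite -(leq_card_setU (val I) (val J)) => /eqP->.
  by rewrite (eqP (valP I)) (eqP (valP J)).
transitivity (\sum_I \sum_J \sum_K T I J K).
  transitivity (\sum_(U : qset d (p + q)) \sum_I \sum_J \sum_K
    if (val I :|: val J == val U)%SET then T I J K else 0).
    apply: eq_bigr => U _.
    under eq_bigr => K _ do rewrite ffunE mulr_sumr mulr_suml.
    rewrite exchange_big; apply: eq_bigr => I _ /=.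
    under eq_bigr => K _ do rewrite mulr_sumr mulr_suml.
    rewrite exchange_big big_mkcond; apply: eq_bigr => J _ /=.
    case: eqP => [eU|_]; last by rewrite big1.
    rewrite big_mkcond; apply: eq_bigr => K _; rewrite /T eU.
    by case: ifP => // _; rewrite !mulrA.
  rewrite exchange_big; apply: eq_bigr => I _ /=.
  rewrite exchange_big; apply: eq_bigr => J _ /=.
  rewrite exchange_big; apply: eq_bigr => K _ /=.
  rewrite -big_mkcond /=.
  case dIJ : [disjoint val I & val J].
    pose U : qset d (p + q) := exist _ (val I :|: val J)%SET (qsetU _ _ _ _ dIJ).
    rewrite (big_pred1 U) // => V; rewrite -(inj_eq val_inj) eq_sym //.
  by rewrite /T /wsign dIJ mulr0 mul0r if_same big1.
transitivity (\sum_I \sum_(V : qset d (q + r)) \sum_J \sum_K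
    if (val J :|: val K == val V)%SET then T I J K else 0).
  apply: eq_bigr => I _.
  rewrite [RHS]exchange_big; apply: eq_bigr => J _ /=.
  rewrite [RHS]exchange_big; apply: eq_bigr => K _ /=.
  rewrite -big_mkcond /=.
  case dJK : [disjoint val J & val K].
    pose V : qset d (q + r) :=
      exist _ (val J :|: val K)%SET (qsetU _ _ _ _ dJK).
    rewrite (big_pred1 V) // => U; rewrite -(inj_eq val_inj) eq_sym //.
  suff -> : T I J K = 0 by rewrite big1.
  by rewrite /T wsignA [wsign (val J) _]/wsign dJK mulr0 mul0r if_same.
apply: eq_bigr => I _; rewrite [RHS]big_mkcond; apply: eq_bigr => V _ /=.
rewrite ffunE; case: eqP => [eL|neL].
  rewrite mulr_sumr; apply: eq_bigr => J _.
  rewrite mulr_sumr [RHS]big_mkcond; apply: eq_bigr => K _ /=.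
  case: eqP => // eV; rewrite /T -finset.setUA eV eL -LL' eqxx.
  by rewrite -eV wsignA eV -!mulrA; congr (_ * _); rewrite mulrCA !mulrA.
rewrite big1 // => J _; rewrite big1 // => K _; case: eqP => // eV.
by rewrite /T -finset.setUA eV LL'; case: eqP.
Qed.

Lemma wedge_alt (m : ext 1) : wedge m m = 0.
Proof.
apply/ffunP => L; rewrite !ffunE.
pose F (I J : qset d 1) : A := if (val I :|: val J == val L)%SET
  then wsign (val I) (val J) * m I * m J else 0.
have q1P (I : qset d 1) : exists i, I == qset1 i.
  by case/cards1P: (valP I) => i Ii; exists i; apply/eqP/val_inj.
have bq1 : bijective (@qset1 d).
  exists (fun I => xchoose (q1P I)) => [i|I]; last by rewrite -(eqP (xchooseP (q1P I))).
  have /eqP/(congr1 val)/= := xchooseP (q1P (qset1 i)).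
  by move/set1_inj.
have F0 i : F (qset1 i) (qset1 i) = 0.
  by rewrite /F /wsign /= -setI_eq0 finset.setIid -cards_eq0 cards1 !mul0r if_same.
have inv1 (i j : 'I_d) : inversions [set i]%SET [set j]%SET = (j < i)%N.
  case: ltnP => ij.
    rewrite /inversions (_ : [set _ in _ | _]%SET = [set (i, j)]%SET) ?cards1 //.
    apply/setP => -[x y]; rewrite !inE /= xpair_eqE.
    by case: eqP => [->|//]; case: eqP => [->|//]; rewrite ij.
  apply: eq_card0 => -[x y]; rewrite !inE /=.
  by case: eqP => [->|//]; case: eqP => [->|//]; rewrite ltnNge ij.
have FN (i j : 'I_d) : (i < j)%N -> F (qset1 j) (qset1 i) = - F (qset1 i) (qset1 j).
  move=> ij; rewrite /F /= finset.setUC; case: ifP => _; last by rewrite oppr0.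
  have ne : i != j by rewrite -val_eqE ltn_eqF.
  rewrite /wsign !disjoints1 !inE [j == i]eq_sym ne /= !inv1 ij.
  by rewrite ltnNge (ltnW ij) /= expr1 expr0 !mulN1r mul1r mulNr mulrC.
transitivity (\sum_(i < d) \sum_(j < d) F (qset1 i) (qset1 j)).
  rewrite (reindex _ (onW_bij _ bq1)); apply: eq_bigr => i _.
  by rewrite big_mkcond (reindex _ (onW_bij _ bq1)).
transitivity (\sum_(i < d) \sum_(j < d | (i < j)%N) F (qset1 i) (qset1 j)
            + \sum_(i < d) \sum_(j < d | (j < i)%N) F (qset1 i) (qset1 j)).
  rewrite -big_split; apply: eq_bigr => i _ /=.
  rewrite (bigD1 i) //= F0 add0r (bigID (fun j : 'I_d => (i < j)%N)) /=.
  congr (_ + _); apply: eq_bigl => j; rewrite -val_eqE; last by case: ltngtP.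
  by case: ltngtP.
rewrite [X in _ + X](exchange_big_dep xpredT) //= -big_split big1 // => i _ /=.
rewrite -big_split big1 // => j ij /=.
by rewrite (FN _ _ ij) subrr.
Qed.

Lemma dx_head q (I : qset d q.+1) (i : 'I_#|val I|) : i = 0%N :> nat ->
  dx I = wedge (dx (qset1 (enum_val i))) (dx (qsetD1 i)).
Proof.
move=> i0; apply/ffunP => L; rewrite !ffunE.
rewrite (bigD1 (qset1 (enum_val i))) //= [X in _ + X]big1 ?addr0; last first.
  by move=> J /negPf nJ; rewrite big1 // => K _; rewrite ffunE nJ mulr0 mul0r.
rewrite big_mkcond (bigD1 (qsetD1 i)) //= [X in _ + X]big1 ?addr0; last first.
  by move=> K /negPf nK; rewrite [dx (qsetD1 i) K]ffunE nK mulr0 if_same.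
rewrite finset.setD1K ?enum_valP // eq_sym val_eqE !ffunE !eqxx !mulr1.
case: eqP => // _.
rewrite /wsign disjoints1 !inE eqxx /= /inversions eq_card0 // => -[x y].
rewrite !inE /=; case: eqP => //= ->; apply/negP => /andP[/andP[ny yI]].
have ltT : transitive (fun a b : 'I_d => (a < b)%N) by move=> a b c; apply: ltn_trans.
have se : sorted (fun a b : 'I_d => (a < b)%N) (enum (val I)).
  rewrite /enum_mem -enumT; apply: (sorted_filter ltT).
  have := iota_ltn_sorted 0 d; rewrite -val_enum_ord sorted_map.
  by apply: sub_sorted => a b.
rewrite -mem_enum -index_mem in yI; rewrite (enum_val_nth y).
case: (posnP (index y (enum (val I)))) => [y0|y_gt0].
  by move: ny; rewrite (enum_val_nth y) i0 -y0 nth_index ?eqxx // -index_mem.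
have := sorted_ltn_nth ltT y se 0%N (index y (enum (val I))).
rewrite !inE (leq_ltn_trans _ yI) // yI => /(_ isT isT y_gt0).
by rewrite nth_index -?index_mem // i0 => /ltnW; rewrite leqNgt => /negP.
Qed.

Lemma wedge_dx0 (m : ext 1) (I : qset d 0) : wedge m (dx I) = m.
Proof.
have I0 (J : qset d 0) : val J = finset.set0 by apply/eqP; rewrite -cards_eq0 (valP J).
apply/ffunP => L; rewrite ffunE (bigD1 L) //= [X in _ + X]big1 ?addr0; last first.
  move=> J neJL; rewrite big_pred0 // => K.
  by rewrite I0 finset.setU0; apply: contraNF neJL; rewrite val_eqE.
rewrite (big_pred1 I) => [|J]; last first.
  by rewrite I0 finset.setU0 eqxx; apply/esym/eqP/val_inj; rewrite !I0.
rewrite ffunE eqxx mulr1 /wsign I0 disjoint_sym -setI_eq0 finset.set0I eqxx.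
rewrite /inversions eq_card0 ?expr0 ?mul1r // => -[x y].
by rewrite !inE /= andbF.
Qed.

End Exterior.

Section DifferenceForms.
Variables (R : comPzRingType) (d : nat) (G : zmodType) (e : 'I_d -> G).
Variable (S : set G).
Hypothesis hS : forall a, S a -> forall i, S (a + e i).

Definition shift (i : 'I_d) (a : S) : S :=
  exist _ (val a + e i) (mem_set (hS (set_mem (valP a)) i)).

Definition pdiff (i : 'I_d) (f : S -> R) : S -> R := fun a => f (shift i a) - f a.

(* For q = 0 the only index is the empty set, so Omega 0 is S -> R and        *)
(* Nmod 0 is free on the symbols [a].                                         *)
Definition Omega (q : nat) : Type := extpow (S -> R) d q.

HB.instance Definition _ q := GRing.Lmodule.on (Omega q).

Definition Nmod (q : nat) : Type := freemod R (S * qset d q)%type.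

HB.instance Definition _ q := GRing.Lmodule.on (Nmod q).

Definition cell q (a : S) (I : qset d q) : Nmod q := fbasis R (a, I).

Definition D1 (f : S -> R) : Omega 1 :=
  \sum_(i < d) (pdiff i f : S -> R) *: (dx (S -> R) (qset1 i) : Omega 1).

(* D q : Omega^q -> Omega^(q+1) and D' q : N_(q+1) -> N_q are the maps        *)
(* written D_(q+1) and D'_(q+1).                                              *)
Definition D (q : nat) (w : Omega q) : Omega q.+1 :=
  \sum_(I : qset d q) (wedge (D1 (w I)) (dx (S -> R) I) : Omega q.+1).

Lemma D0E (w : Omega 0) (I : qset d 0) : D w = D1 (w I).
Proof.
have I0 (J : qset d 0) : J = I.
  by apply: val_inj; rewrite (cards0_eq (eqP (valP I))) (cards0_eq (eqP (valP J))).
rewrite /D (bigD1 I) //= big1 => [|J]; last by rewrite (I0 J) eqxx.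
by rewrite addr0 wedge_dx0.
Qed.

Definition D'cell (q : nat) (a : S) (I : qset d q.+1) : Nmod q :=
  \sum_(i < #|val I|) (-1) ^+ i *:
     (cell (shift (enum_val i) a) (qsetD1 i) - cell a (qsetD1 i)).

Definition D' (q : nat) (c : Nmod q.+1) : Nmod q :=
  lext (fun k => D'cell k.1 k.2) c.

Definition B (q : nat) (w : Omega q) (c : Nmod q) : R :=
  lext (fun k => (w k.2 : S -> R) k.1 : R^o) c.

End DifferenceForms.

(* Main.v *)
(** In coordinates, (D w)_X is the sum over i in X of (-1)^k d_i w_(X \ i),
    where k is the number of elements of X below i.  This formula is the
    transpose of the one for D', which gives the duality.  In D (D w) the terms
    for (i, j) and (j, i) cancel, since the difference operators commute while
    the signs are opposite.  As the pairing B is nondegenerate in the chain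
    variable, D' D' = 0 follows from D D = 0 by duality. *)

Require Import Defs.
From HB Require Import structures.
From mathcomp Require Import all_boot all_order all_algebra.
From mathcomp Require Import classical_sets functions.
From mathcomp Require Import finmap boolp.
From mathcomp.multinomials Require Import monalg.
Import GRing.Theory.
Local Open Scope ring_scope.

Set Implicit Arguments.
Unset Strict Implicit.
Unset Printing Implicit Defensive.

(** [enum X] is a filter of the increasing enumeration of ['I_d], hence sorted. *)
Lemma ltn_enum_val d (X : {set 'I_d}) (i j : 'I_#|X|) :
  (enum_val i < enum_val j)%N = (i < j)%N.
Proof.
have ltT : transitive (fun a b : 'I_d => (a < b)%N).
  by move=> a b c; apply: ltn_trans.
have se : sorted (fun a b : 'I_d => (a < b)%N) (enum X).
  rewrite /enum_mem -enumT; apply: (sorted_filter ltT).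
  have := iota_ltn_sorted 0 d; rewrite -val_enum_ord sorted_map.
  by apply: sub_sorted => a b.
have mono (k l : 'I_#|X|) : (k < l)%N -> (enum_val k < enum_val l)%N.
  move=> kl; have x0 : 'I_d := enum_val k; rewrite !(enum_val_nth x0).
  by apply: (sorted_ltn_nth ltT _ se) => //; rewrite inE -cardE ltn_ord.
case: (ltngtP i j) => [/mono //|/mono ji|/val_inj->]; last by rewrite ltnn.
by rewrite ltnNge (ltnW ji).
Qed.

(** The elements of [X] below its [i]-th one are those at the positions [k < i]. This matches the
    sign in [wedge], which counts inversions, with the sign [(-1) ^+ i] in [D'cell]. *)
Lemma inversions_enum_val d (X : {set 'I_d}) (i : 'I_#|X|) :
  inversions [set enum_val i]%SET (X :\ enum_val i)%SET = i.
Proof.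
pose f (k : 'I_#|X|) := (enum_val i, enum_val k).
have injf : injective f by move=> k l [] /enum_val_inj.
transitivity #|[set f k | k in [set k : 'I_#|X| | (k < i)%N]]%SET|.
  apply: eq_card => -[x y]; rewrite !inE /=; apply/idP/imsetP => /=.
    case/andP=> /andP[/eqP-> /andP[_ yX]] yi.
    exists (enum_rank_in yX y); last by rewrite /f enum_rankK_in.
    by rewrite inE -ltn_enum_val enum_rankK_in.
  case=> k; rewrite inE => ki [-> ->]; rewrite eqxx enum_valP ltn_enum_val ki.
  by rewrite (inj_eq enum_val_inj) -val_eqE (ltn_eqF ki).
rewrite card_imset // -sum1dep_card.
by rewrite -(big_ord_widen _ (fun=> 1%N) (ltnW (ltn_ord i))) sum1_card card_ord.
Qed.

(** The terms above the diagonal cancel those below it. The diagonal is assumed zero separately,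
    since antisymmetry alone would only give [2 F i i = 0]. *)
Lemma sum_antisym (V : zmodType) d (F : 'I_d -> 'I_d -> V) :
    (forall i, F i i = 0) -> (forall i j : 'I_d, (i < j)%N -> F j i = - F i j) ->
  \sum_i \sum_j F i j = 0.
Proof.
move=> F0 FN.
transitivity (\sum_(i < d) \sum_(j < d | (i < j)%N) F i j
            + \sum_(i < d) \sum_(j < d | (j < i)%N) F i j).
  rewrite -big_split; apply: eq_bigr => i _ /=.
  rewrite (bigD1 i) //= F0 add0r (bigID (fun j : 'I_d => (i < j)%N)) /=.
  by congr (_ + _); apply: eq_bigl => j; rewrite -val_eqE; case: ltngtP.
rewrite [X in _ + X](exchange_big_dep xpredT) //= -big_split big1 // => i _ /=.
by rewrite -big_split big1 // => j ij /=; rewrite (FN _ _ ij) subrr.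
Qed.

Lemma inversions1 d (i j : 'I_d) :
  inversions [set i]%SET [set j]%SET = (j < i)%N.
Proof.
rewrite /inversions; case: ltnP => ij.
  rewrite (_ : [set _ in _ | _]%SET = [set (i, j)]%SET) ?cards1 //.
  apply/setP => -[x y]; rewrite !inE /= xpair_eqE.
  by case: eqP => [->|//]; case: eqP => [->|//]; rewrite ij.
apply: eq_card0 => -[x y]; rewrite !inE /=.
by case: eqP => [->|//]; case: eqP => [->|//]; rewrite ltnNge ij.
Qed.

(** Deleting [j] lowers the exponent of the sign of [i] by one exactly when [j < i]. This produces
    the opposite signs in [D (D w)]. *)
Lemma inversionsD1 d (X : {set 'I_d}) (i j : 'I_d) : j \in X -> i != j ->
  inversions [set i]%SET (X :\ i)%SET =
  ((j < i) + inversions [set i]%SET (X :\ i :\ j)%SET)%N.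
Proof.
move=> jX ij; rewrite -inversions1 -inversionsUr ?finset.setD1K //.
  by rewrite !inE eq_sym ij.
by rewrite disjoints1 !inE eqxx.
Qed.

Lemma wedge_dx (A : comPzRingType) d p q (I : qset d p) (J : qset d q) L :
  wedge (dx A I) (dx A J) L =
  if (val I :|: val J == val L)%SET then wsign A (val I) (val J) else 0.
Proof.
rewrite ffunE (bigD1 I) //= [X in _ + X]big1 ?addr0; last first.
  by move=> K /negPf nK; rewrite big1 // => K' _; rewrite ffunE nK mulr0 mul0r.
rewrite big_mkcond (bigD1 J) //= [X in _ + X]big1 ?addr0; last first.
  by move=> K /negPf nK; rewrite [dx A J K]ffunE nK mulr0 if_same.
by rewrite !ffunE !eqxx !mulr1.
Qed.

Section DifferenceForms.
Variables (R : comPzRingType) (d : nat) (G : zmodType) (e : 'I_d -> G).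
Variables (S : set G) (hS : forall a, S a -> forall i, S (a + e i)).

(* Indexing coefficients by arbitrary sets, with value 0 at a wrong           *)
(* cardinality, avoids cardinality proofs when indices are removed.           *)
Definition coef q (w : Omega R d S q) (X : {set 'I_d}) : S -> R :=
  if insub X is Some J then w J else 0.

Lemma coef_val q (w : Omega R d S q) (I : qset d q) : coef w (val I) = w I.
Proof. by rewrite /coef valK. Qed.

Lemma coef_out q (w : Omega R d S q) (X : {set 'I_d}) : #|X| != q -> coef w X = 0.
Proof. by move=> nX; rewrite /coef insubN. Qed.

Lemma coef_D_fun q (w : Omega R d S q) (X : {set 'I_d}) :
  coef (D hS w) X = \sum_(i in X)
    (-1) ^+ inversions [set i]%SET (X :\ i)%SET
      * pdiff hS i (coef w (X :\ i)%SET).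
Proof.
have pdiff0 i : pdiff hS i (0 : S -> R) = 0 by apply/funext => a; exact: subrr.
(* At a wrong cardinality both sides vanish: if [X] does not have [q.+1] elements, then removing one
   of them does not leave [q]. *)
have [cX|nX] := boolP (#|X| == q.+1); last first.
  rewrite coef_out // big1 // => i iX; rewrite coef_out ?pdiff0 ?mulr0 //.
  by apply: contra nX => /eqP cX; rewrite (cardsD1 i) iX cX.
rewrite -[X in LHS]/(val (exist _ X cX : qset d q.+1)) coef_val.
set L : qset d q.+1 := exist _ X cX.
have -> : D hS w = \sum_(I : qset d q) \sum_(i < d)
    (pdiff hS i (w I) : S -> R) *: wedge (dx (S -> R) (qset1 i)) (dx (S -> R) I).
  apply: eq_bigr => I _; rewrite /D1.
  (* Wedging with [dx I] on the right is packed as a linear map, so that it passes through the sum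
     in [D1]. *)
  pose f := GRing.isLinear.Build _ _ _ _ _ (wedge_linearl (p := 1) (dx (S -> R) I)).
  pose g : {linear extpow (S -> R) d 1 -> extpow (S -> R) d q.+1} :=
    HB.pack (fun u => wedge u (dx (S -> R) I)) f.
  rewrite -[LHS]/(g _) linear_sum; apply: eq_bigr => i _.
  by rewrite linearZ.
rewrite exchange_big sum_ffunE [RHS]big_mkcond; apply: eq_bigr => i _ /=.
rewrite sum_ffunE; under eq_bigr => I _ do rewrite ffunE wedge_dx /=.
case: ifPn => [iX|niX]; last first.
  rewrite big1 // => I _; case: eqP => [eX|_]; last by rewrite scaler0.
  by case/negP: niX; rewrite -eX !inE eqxx.
have cXi : #|(X :\ i)%SET| == q by have := cX; rewrite (cardsD1 i) iX.
pose J : qset d q := exist _ (X :\ i)%SET cXi.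
(* For [I] other than [X] without [i] the term vanishes: either [i] and [I] do not make up [X], or
   [I] contains [i] and the sign is 0. *)
rewrite (bigD1 J) //= big1 ?addr0 => [|I nIJ]; last first.
  case: eqP => [eX|_]; last by rewrite scaler0.
  rewrite /wsign disjoints1; case: ifP => [niI|_]; last by rewrite scaler0.
  case/eqP: nIJ; apply: val_inj => /=; rewrite -eX.
  by rewrite setU1K.
rewrite finset.setD1K // eqxx /wsign disjoints1 !inE eqxx /=.
by rewrite -[(X :\ i)%SET]/(val J) coef_val /GRing.scale /= mulrC.
Qed.

Lemma coef_D q (w : Omega R d S q) (X : {set 'I_d}) (a : S) :
  coef (D hS w) X a = \sum_(i in X)
    (-1) ^+ inversions [set i]%SET (X :\ i)%SET
      * pdiff hS i (coef w (X :\ i)%SET) a.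
Proof.
rewrite coef_D_fun fct_sumE; apply: eq_bigr => i _.
(* On the left the sign is a power in the ring [S -> R], on the right one in [R]. Only the parity of
   the exponent matters, which leaves the constants 1 and -1. *)
rewrite -signr_odd -[in RHS]signr_odd.
by case: odd; rewrite ?expr0 ?expr1 ?mul1r ?mulN1r.
Qed.

Lemma shiftC i j (a : S) : shift hS i (shift hS j a) = shift hS j (shift hS i a).
Proof. by apply: val_inj; rewrite /= addrAC. Qed.

Lemma pdiffC i j (f : S -> R) :
  pdiff hS i (pdiff hS j f) = pdiff hS j (pdiff hS i f).
Proof.
by apply/funext => a; rewrite /pdiff (shiftC i j) !opprD addrACA.
Qed.

Lemma DD_eq0 q (w : Omega R d S q) : D hS (D hS w) = 0.
Proof.
suff E X : coef (D hS (D hS w)) X = 0.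
  by apply/ffunP => L; rewrite -coef_val E ffunE.
apply/funext => a; rewrite coef_D.
(* The term where [i] is removed first and [j] second, extended by 0 to all pairs of indices. *)
pose F i j : R := if (i \in X) && (j \in X :\ i)%SET then
  (-1) ^+ inversions [set i]%SET (X :\ i)%SET *
  ((-1) ^+ inversions [set j]%SET (X :\ i :\ j)%SET *
   pdiff hS i (pdiff hS j (coef w (X :\ i :\ j)%SET)) a) else 0.
transitivity (\sum_i \sum_j F i j).
  rewrite big_mkcond; apply: eq_bigr => i _ /=.
  rewrite /F; case: ifP => iX /=; last by rewrite big1.
  rewrite -big_mkcond /= -mulr_sumr; congr (_ * _).
  rewrite {1}/pdiff !coef_D -sumrB; apply: eq_bigr => j _.
  by rewrite -mulrBr.
apply: sum_antisym => [i|i j ij]; first by rewrite /F !inE eqxx andbF.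
have nij : i != j by rewrite -val_eqE ltn_eqF.
rewrite /F !inE nij [j == i]eq_sym nij /= [(j \in X) && _]andbC.
case: ifP => [/andP[iX jX]|_]; last by rewrite oppr0.
(* As [i < j], removing [j] does not change the exponent of [i], while removing [i] lowers that of
   [j] by one: this is the single sign by which the two terms differ. *)
rewrite (inversionsD1 jX nij) (inversionsD1 iX) //; last by rewrite eq_sym.
rewrite ij ltnNge (ltnW ij) /= pdiffC.
have -> : (X :\ j :\ i = X :\ i :\ j)%SET by rewrite !finset.setDDl finset.setUC.
by rewrite exprS mulN1r mulNr mulrCA.
Qed.

Lemma B_D q (w : Omega R d S q) (c : Nmod R d S q.+1) :
  B (D hS w) c = B w (D' hS c).
Proof.
pose h (k : S * qset d q) : R^o := (w k.2 : S -> R) k.1.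
(* Both sides become sums over the support of [c], so it suffices to compare them on one cell. *)
rewrite -[RHS]/(lext h (\sum_(k <- msupp c) c@_k *: D'cell R hS k.1 k.2)).
rewrite linear_sum; apply: eq_bigr => -[a L] _ /=.
rewrite [RHS]linearZ; apply: (congr1 (fun r : R^o => c@_(a, L) *: r)).
rewrite /D'cell linear_sum.
(* The sum over the elements of [L] is reindexed by their positions, as in [D'cell]. *)
rewrite -coef_val coef_D big_enum_val /=; apply: eq_bigr => i _.
rewrite linearZ linearB /= !lext_basis /= inversions_enum_val.
by rewrite -[(val L :\ _)%SET]/(val (qsetD1 i)) coef_val.
Qed.

Lemma B_nondegenerate q (c : Nmod R d S q) :
  (forall w : Omega R d S q, B w c = 0) -> c = 0.
Proof.
move=> Bc0; apply/malgP => -[a I]; rewrite mcoeff0.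
(* Pairing with the indicator form of [(a, I)] reads off the coefficient of [c] there. *)
pose w : Omega R d S q := [ffun J => fun b => ((b, J) == (a, I))%:R].
rewrite -(Bc0 w) /B /lext.
have [kc|kc] := boolP ((a, I) \in msupp c); last first.
  rewrite mcoeff_outdom // big_seq big1 // => -[b J] bc /=.
  rewrite ffunE; case: eqP => [E|_]; last by rewrite scaler0.
  by rewrite -E bc in kc.
rewrite (big_fsetD1 _ kc) /= ffunE eqxx big_seq big1 => [|[b J]].
  by rewrite addr0 /GRing.scale /= mulr1.
by rewrite in_fsetD1 => /andP[/negPf nk _]; rewrite ffunE nk scaler0.
Qed.

End DifferenceForms.

Theorem theorem1 (R : comPzRingType) (d : nat) (G : zmodType)
    (e : 'I_d -> G) (S : set G) (hd : (0 < d)%N) (he : injective e)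
    (hS : forall a, S a -> forall i, S (a + e i)) :
  [/\ forall q, (q.+1 < d)%N ->
        forall w : Omega R d S q, D hS (D hS w) = 0,
      forall q, (q.+1 < d)%N ->
        forall c : Nmod R d S q.+2, D' hS (D' hS c) = 0
    & forall q, (q < d)%N ->
        forall (w : Omega R d S q) (c : Nmod R d S q.+1),
          B (D hS w) c = B w (D' hS c)].
Proof.
split=> [q _ w|q _ c|q _ w c]; [exact: DD_eq0| |exact: B_D].
apply: B_nondegenerate => w; rewrite -!B_D DD_eq0 /B /lext big1 // => k _.
by rewrite ffunE scaler0.
Qed.
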